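(* Let $q_0, t$ be positive integers such that $q := t q_0^2$ is a power of $2$. Let $S := \langle q,\ q+q_0,\ q+tq_0,\ (t-1)q + tq_0 + 1\rangle$ (the Pedersen–Sørensen semigroup in even characteristic) and $g := \frac{q(q-1)}{2q_0}$. Then $g - \frac{q}{2} \in S\cap[0,c(S)]$ and $\sigma$ attains its maximum over $S \cap [0,c(S)]$ at $g - \frac{q}{2}$.
   Context: A numerical semigroup is a subset $S \subseteq \mathbb{N} = \{0,1,2,\ldots\}$ closed under addition, containing $0$, with finite complement. Its Frobenius number is $F(S) := \max(\mathbb{N}\setminus S)$ and its conductor is $c(S) := F(S)+1$. For $s \in S \cap [0,c(S)]$ define $\sigma(s) := \frac{s}{2} - |S \cap [0,s]| + 1$. The semigroup $S$ is symmetric with genus $|\mathbb{N}\setminus S| = g$.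
   Formalization: The formal theorem assumes t ≥ 2 instead of t ≥ 1: for t = 1 the claim always fails, since g − q/2 is not in S (e.g. q_0 = 2, t = 1 gives S = ⟨3,4⟩ and g − q/2 = 1). *)

(* Defs.v *)
From mathcomp Require Import all_boot all_order all_algebra.
From mathcomp Require Import boolp classical_sets functions cardinality.

Set Implicit Arguments.
Unset Strict Implicit.
Unset Printing Implicit Defensive.

Import Order.TTheory GRing.Theory Num.Theory.

Local Open Scope classical_set_scope.

Definition additive_submonoid (S : set nat) : Prop :=
  S 0 /\ forall m n, S m -> S n -> S (m + n).

Definition numerical_semigroup (S : set nat) : Prop :=
  additive_submonoid S /\ finite_set (~` S).

Definition generated_by (A : set nat) : set nat :=
  smallest additive_submonoid A.

(* max (N \ S); the default value 0 is only taken when N \ S has no maximum,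
   i.e. is empty or infinite (see [frobeniusP]). *)
Definition frobenius (S : set nat) : nat :=
  xget 0 (~` S `&` [set F | forall n, (~` S) n -> n <= F]).

Definition conductor (S : set nat) : nat := frobenius S + 1.

Definition up_to_conductor (S : set nat) : set nat :=
  S `&` [set s | s <= conductor S].

Definition count_upto (S : set nat) (s : nat) : nat :=
  #|[pred i : 'I_s.+1 | (i : nat) \in S]|.

Definition sigma (S : set nat) (s : nat) : rat :=
  (s%:R / 2 - (count_upto S s)%:R + 1)%R.

Definition ps_semigroup (q0 t : nat) : set nat :=
  let q := t * q0 ^ 2 in
  generated_by [set q; q + q0; q + t * q0; (t - 1) * q + t * q0 + 1].

Lemma generated_by_submonoid (A : set nat) :
  additive_submonoid (generated_by A).
Proof.
split=> [M [[M0 _] _] //|m n Sm Sn M MP].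
by have [[_ MD] _] := MP; apply: MD; [apply: Sm|apply: Sn].
Qed.

Lemma frobeniusP (S : set nat) : numerical_semigroup S -> S != setT ->
  ~ S (frobenius S) /\ forall n, ~ S n -> n <= frobenius S.
Proof.
move=> [_ finS] properS.
have [x Sx] : exists x, ~ S x.
  apply: contrapT => noS; move/eqP: properS; apply.
  by rewrite -subTset => n _; apply: contrapT => Sn; apply: noS; exists n.
suff [F FP] : exists F, (~` S `&` [set F | forall n, (~` S) n -> n <= F]) F.
  exact: (xgetI 0 FP).
have exS : exists n, n \in ~` S by exists x; rewrite inE.
have [N boundN] : exists N, forall n, n \in ~` S -> n <= N.
  have /finite_seqP[s Es] := finS; exists (\max_(i <- s) i) => n.
  rewrite inE Es => /= ns.
  exact: (leq_bigmax_seq _ ns).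
case: (ex_maxnP exS boundN) => F; rewrite inE => SF maxF.
by exists F; split=> //= n Sn; apply: maxF; rewrite inE.
Qed.

(* The hypothesis 1 < t is needed: for t = 1 the generators reduce to q0 ^ 2
   and q0 + 1, and g - q / 2 is then not in the semigroup. *)
Lemma ps_semigroup_numerical (q0 t : nat) :
  0 < q0 -> 1 < t -> (exists k, t * q0 ^ 2 = 2 ^ k) ->
  numerical_semigroup (ps_semigroup q0 t) /\ ps_semigroup q0 t != setT.
Proof.
move=> q0_gt0 t_gt1 [k qE].
have [S0 SD] : additive_submonoid (ps_semigroup q0 t).
  exact: generated_by_submonoid.
have q_gt1 : 1 < t * q0 ^ 2.
  by apply: leq_trans t_gt1 _; rewrite leq_pmulr // expn_gt0 q0_gt0.
have even_t : ~~ odd t.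
  have /(dvdn_pfactor _ _ (isT : prime 2))[[|j] _ tE] : t %| 2 ^ k.
  - by rewrite -qE dvdn_mulr.
  - by rewrite tE in t_gt1.
  - by rewrite tE oddX.
pose a := t * q0 ^ 2; pose b := (t - 1) * a + t * q0 + 1.
have SM c n : ps_semigroup q0 t c -> ps_semigroup q0 t (c * n).
  by move=> Sc; elim: n => [|n IH]; rewrite ?muln0 // mulnS; apply: SD.
have Sa : ps_semigroup q0 t a by move=> M [_]; apply; left; left; left.
have Sb : ps_semigroup q0 t b by move=> M [_]; apply; right.
have b_odd : odd b.
  by rewrite /b /a !oddD !oddM (negbTE even_t) andbF.
have co_ab : coprime a b by rewrite /a qE coprimeXl // coprime2n.
have a_gt0 : 0 < a by apply: ltnW.
have b_gt0 : 0 < b by rewrite /b addn1.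
have big n : a * b <= n -> ps_semigroup q0 t n.
  move=> le_n; pose x := chinese a b n 0 %% (a * b).
  have lt_x : x < a * b by rewrite ltn_mod muln_gt0 a_gt0.
  have le_xn : x <= n by apply: leq_trans le_n; apply: ltnW.
  have b_x : b %| x.
    rewrite /dvdn (modn_dvdm _ (dvdn_mull a (dvdnn b))).
    by rewrite (chinese_modr co_ab n 0) mod0n.
  have a_nx : a %| n - x.
    rewrite -eqn_mod_dvd // /x (modn_dvdm _ (dvdn_mulr b (dvdnn a))).
    by rewrite (chinese_modl co_ab n 0).
  have Sx : ps_semigroup q0 t x by rewrite -(divnK b_x) mulnC; apply: SM.
  have Snx : ps_semigroup q0 t (n - x).
    by rewrite -(divnK a_nx) mulnC; apply: SM.
  by have := SD _ _ Snx Sx; rewrite subnK.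
split.
  split=> //; apply: (@sub_finite_set _ _ `I_(a * b)); last exact: finite_II.
  by move=> n Sn /=; rewrite ltnNge; apply/negP => /big.
apply/eqP => ST.
have : ps_semigroup q0 t 1 by rewrite ST.
move=> /(_ [set n | n <> 1]) /=; apply=> //; split.
  by split=> // -[|[|m]] [|[|n]].
have aq0 : 1 < a + q0 by rewrite ltn_addr.
have atq0 : 1 < a + t * q0 by rewrite ltn_addr.
have b1 : 1 < b by rewrite /b addn1 ltnS addn_gt0 (muln_gt0 t q0) q0_gt0 (ltnW t_gt1) orbT.
by move=> n [[[|]|]|] ->; rewrite -/a -?/b; apply/eqP; rewrite gtn_eqF.
Qed.

(* Main.v *)
(* Let [h s] be the number of gaps of [S] below [s] minus the number of elements
   of [S] below [s]; on [S], [sigma s] is [h s / 2]. With [w] the last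
   generator, every integer is uniquely
   [i q + j (q + t q0) + k (q + q0) + l w] with [0 <= j, l < q0], [0 <= k < t],
   and it lies in [S] iff [i >= 0]; this gives the symmetry of [S], hence
   [h (2 g - s) = h s]. Since [S + q] is included in [S], [h] is concave along
   each residue class modulo [q]. So it is enough to compare [h] with its value
   at [g - q / 2] on the interval [[g - q / 2, g]], and there every integer whose
   remainder modulo [q0] is less than [q0 / 2] is in [S]. *)

Require Import Defs.
From mathcomp Require Import all_boot all_order all_algebra.
From mathcomp Require Import boolp classical_sets functions cardinality.
From mathcomp Require Import zify ring lra.

Import Order.TTheory GRing.Theory Num.Theory.

Local Open Scope classical_set_scope.

(** * Counting elements and gaps below a bound *)

Definition count_below (P : pred nat) (s : nat) : nat := \sum_(i < s) P i.

Lemma count_belowS (P : pred nat) (s : nat) :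
  count_below P s.+1 = count_below P s + P s.
Proof. by rewrite /count_below big_ord_recr. Qed.

(** The reflection preserves the integers from [g - d] to [g + d - 1] and exchanges elements with
    gaps, so exactly [d] of these [2 * d] integers are elements. *)
Lemma count_below_symmetric (P : pred nat) (g d : nat) :
    (forall n, n < 2 * g -> P (2 * g - 1 - n) = ~~ P n) -> d <= g ->
  count_below P (g + d) = count_below P (g - d) + d.
Proof.
move=> symP; elim: d => [|d IH] le_dg; first by rewrite addn0 subn0 addn0.
rewrite addnS count_belowS IH 1?ltnW //.
have -> : g - d = (g - d.+1).+1 by lia.
have := symP (g - d.+1); have -> : 2 * g - 1 - (g - d.+1) = g + d by lia.
by move=> ->; [rewrite count_belowS; case: (P _) => /=; lia | lia].
Qed.

(** Moving a window of length [q] up by one drops [a] and gains [a + q], an element whenever [a] is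
    one. *)
Lemma count_below_window_mono (P : pred nat) (q a b : nat) :
    (forall n, P n -> P (n + q)) -> a <= b ->
  count_below P (a + q) + count_below P b
    <= count_below P (b + q) + count_below P a.
Proof.
move=> Pq /subnK <-; elim: (b - a) => [|d IH]; first by rewrite add0n.
rewrite !addSn !count_belowS.
have := Pq (d + a); case: (P (d + a)) => [/(_ isT) ->|_] /=; lia.
Qed.

(* Along a residue class modulo [2 * p] the excess of gaps over elements is
   concave, with equal values at [g - p] and [g + p]; so it is largest inside
   [[g - p, g + p]], and symmetry leaves only the first half of that window. *)
Lemma gap_excess_max (P : pred nat) (g p : nat) :
    0 < p -> p <= g ->
    (forall n, P n -> P (n + 2 * p)) ->
    (forall n, n < 2 * g -> P (2 * g - 1 - n) = ~~ P n) ->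
    (forall s, g - p <= s <= g ->
      s + 2 * count_below P (g - p) <= g - p + 2 * count_below P s) ->
  forall s, s + 2 * count_below P (g - p) <= g - p + 2 * count_below P s.
Proof.
move=> p_gt0 le_pg Pq symP half; set m := g - p.
have mq : count_below P (m + 2 * p) = count_below P m + p.
  have -> : m + 2 * p = g + p by rewrite /m; lia.
  exact: count_below_symmetric.
have window s : m <= s <= m + 2 * p ->
    s + 2 * count_below P m <= m + 2 * count_below P s.
  move=> /andP[le_ms le_sm]; have [le_sg|lt_gs] := leqP s g.
    by apply: half; rewrite le_ms.
  have := count_below_symmetric P g (s - g) symP.
  have -> : g + (s - g) = s by lia.
  have := half (g - (s - g)); rewrite /m in le_ms le_sm *; lia.
(* Windows of length [2 * p] starting from [m] on hold at least [p] elements, those starting below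
   at most [p]; so steps of [2 * p] towards the central window never lower the excess. *)
have above k s : s <= k -> m <= s ->
    s + 2 * count_below P m <= m + 2 * count_below P s.
  elim: k s => [|k IH] s le_sk le_ms; first by apply: window; lia.
  have [le_sm|lt_ms] := leqP s (m + 2 * p); first by apply: window; lia.
  have := IH (s - 2 * p); have := @count_below_window_mono P _ m (s - 2 * p) Pq.
  have -> : s - 2 * p + 2 * p = s by lia.
  by rewrite mq; lia.
have below k s : m - s <= k ->
    s + 2 * count_below P m <= m + 2 * count_below P s.
  elim: k s => [|k IH] s le_sk; first by apply: (above s) => //; lia.
  have [le_ms|lt_sm] := leqP m s; first exact: (above s).
  have := IH (s + 2 * p); have := @count_below_window_mono P _ s m Pq (ltnW lt_sm).
  by rewrite mq; lia.
by move=> s; apply: (below (m - s)).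
Qed.

(* A gap lies in the upper half of its block of length [b], so translating by
   half a block injects the gaps into the elements. *)
Lemma count_below_half_blocks (P : pred nat) (a b n : nat) :
    b = 1 \/ ~~ odd b -> 0 < b ->
    (forall x, x < n -> 2 * (x %% b) < b -> P (a + x)) ->
  n + 2 * count_below P a <= 2 * count_below P (a + n).
Proof.
move=> b_par b_gt0 Pn.
(* The [minn] term is the surplus of elements guaranteed in the current block: it grows over the
   first half and pays for possible gaps in the second. *)
suff strong x : x <= n ->
    x + 2 * count_below P a + minn (x %% b) (b - x %% b)
      <= 2 * count_below P (a + x).
  have := strong n (leqnn n); lia.
elim: x => [|x IH] lt_xn; first by rewrite mod0n addn0; lia.
rewrite addnS count_belowS; have := IH (ltnW lt_xn); have Px := Pn x lt_xn.
have lt_xb : x %% b < b by rewrite ltn_mod.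
have -> : x.+1 %% b = if (x %% b).+1 == b then 0 else (x %% b).+1.
  rewrite -addn1 -modnDml addn1; case: eqP => [->|?]; first exact: modnn.
  by rewrite modn_small //; lia.
move: lt_xb Px; move: (x %% b) => r lt_rb Px.
have [/Px -> /=|ge_rb2] := ltnP (2 * r) b; case: eqP; move: b_par; first by lia.
- by lia.
- by case: (P _) => /=; lia.
- by case: (P _) => /=; lia.
Qed.

(** * Membership in the semigroup and its symmetry *)

Lemma generated_by_mulr (A : set nat) (c n : nat) :
  A c -> generated_by A (n * c).
Proof.
move=> Ac; have [S0 SD] := generated_by_submonoid A.
by elim: n => // n IH; rewrite mulSn; apply: SD => // M [_]; apply.
Qed.

Lemma ps_semigroupP (q0 t n : nat) :
  ps_semigroup q0 t n <-> exists i j k l : nat,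
    n = i * (t * q0 ^ 2) + j * (t * q0 ^ 2 + t * q0) + k * (t * q0 ^ 2 + q0)
        + l * ((t - 1) * (t * q0 ^ 2) + t * q0 + 1).
Proof.
split=> [|[i [j [k [l ->]]]]]; last first.
  have [_ SD] := generated_by_submonoid
    [set t * q0 ^ 2; t * q0 ^ 2 + q0; t * q0 ^ 2 + t * q0;
         (t - 1) * (t * q0 ^ 2) + t * q0 + 1].
  refine (SD _ _ (SD _ _ (SD _ _ _ _) _) _).
  - by apply: generated_by_mulr; left; left; left.
  - by apply: generated_by_mulr; left; right.
  - by apply: generated_by_mulr; left; left; right.
  - by apply: generated_by_mulr; right.
set w := (t - 1) * _ + _ + 1 => /(_ [set n | exists i j k l : nat,
  n = i * (t * q0 ^ 2) + j * (t * q0 ^ 2 + t * q0) + k * (t * q0 ^ 2 + q0)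
      + l * w]); apply; split; first split.
- by exists 0, 0, 0, 0.
- move=> _ _ [i [j [k [l ->]]]] [i' [j' [k' [l' ->]]]].
  by exists (i + i'), (j + j'), (k + k'), (l + l'); ring.
- move=> _ [[[->|->]|->]|->].
  + by exists 1, 0, 0, 0; ring.
  + by exists 0, 0, 1, 0; ring.
  + by exists 0, 1, 0, 0; ring.
  + by exists 0, 0, 0, 1; rewrite !mul0n mul1n.
Qed.

Lemma muln_split (d x y z : nat) : d * x + y = d * z -> exists c, y = d * c.
Proof.
move=> E; have : d %| d * x + y by rewrite E dvdn_mulr.
by rewrite dvdn_addr ?dvdn_mulr // => /dvdnP[c ->]; exists c; rewrite mulnC.
Qed.

(* In [F = i q + j (q + t q0) + k (q + q0) + l w], reading modulo [q0], then
   [t], then [q0] again gives [l + 1 = q0 a], [k + a = t b] and [j + b = q0 d]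
   with [a, b, d > 0], which makes the right-hand side too large. *)
Lemma ps_frobenius_gap (q0 t F : nat) :
    0 < q0 -> 1 < t -> F + 1 + t * q0 = t * q0 * (t * q0 ^ 2) ->
  ~ ps_semigroup q0 t F.
Proof.
move=> q0_gt0; case: t => // -[//|t] _ EF /ps_semigroupP[i [j [k [l FE]]]].
move: EF; rewrite {}FE subSS subn0 -mulnn; set T := t.+2 => E.
have [a al] : exists a, l.+1 = q0 * a.
  apply: (@muln_split _
    (i * T * q0 + j * (T * q0 + T) + k * (T * q0 + 1)
      + l * (t.+1 * T * q0 + T) + T) _ (T * q0 * T * q0)).
  by move: E; lia.
have Ea : i * T * q0 + j * (T * q0 + T) + k * (T * q0 + 1)
    + a * (t.+1 * T * q0 * q0 + T * q0 + 1) = t.+1 * T * q0 + T * T * q0 * q0.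
  apply/eqP; rewrite -(eqn_pmul2l q0_gt0); apply/eqP.
  have := congr1 (fun x => x * (t.+1 * T * q0 * q0 + T * q0 + 1)) al.
  by move: E; rewrite /=; lia.
have [b bl] : exists b, k + a = T * b.
  apply: (@muln_split _
    (i * q0 + j * (q0 + 1) + k * q0 + a * (t.+1 * q0 * q0 + q0)) _
    (t.+1 * q0 + T * q0 * q0)).
  by move: Ea; lia.
have Eb : i * q0 + j * (q0 + 1) + b * (T * q0 + 1) + a * t.+1 * q0 * q0
    = t.+1 * q0 + T * q0 * q0.
  apply/eqP; rewrite -(eqn_pmul2l (isT : 0 < T)); apply/eqP.
  have := congr1 (fun x => x * (T * q0 + 1)) bl.
  by move: Ea; rewrite /=; lia.
have [d dl] : exists d, j + b = q0 * d.
  apply: (@muln_split _ (i + j + b * T + a * t.+1 * q0) _ (t.+1 + T * q0)).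
  by move: Eb; lia.
have Ed : i + j + b * T + a * t.+1 * q0 + d = t.+1 + T * q0.
  by apply/eqP; rewrite -(eqn_pmul2l q0_gt0); apply/eqP; move: Eb dl; lia.
have a_gt0 : 0 < a by case: (a) al => //; rewrite muln0.
have b_gt0 : 0 < b by case: (b) bl => //; rewrite muln0; lia.
have d_gt0 : 0 < d by case: (d) dl => //; rewrite muln0; lia.
(* With [dl] substituted in [Ed], these three terms already reach the right-hand side, while
   [i + d > 0] is left over. *)
have : b * t.+1 + a * (t.+1 * q0) + q0 * d >= t.+1 + t.+1 * q0 + q0.
  by rewrite !leq_add ?leq_pmull ?leq_pmulr.
by move: Ed dl; rewrite /T; lia.
Qed.

(* Writing [n = q0 (t z + k) + l] and [z + q0 = q0 (c + 1) + j + l] with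
   remainders [l, j < q0] and [k < t] puts [n] in the normal form
   [i q + j (q + t q0) + k (q + q0) + l w] with [i] an integer; replacing
   [(i, j, k, l)] by [(-1 - i, q0 - 1 - j, t - 1 - k, q0 - 1 - l)] gives
   [F - n]. *)
Lemma ps_semigroup_cover (q0 t F n : nat) :
    0 < q0 -> 1 < t -> F + 1 + t * q0 = t * q0 * (t * q0 ^ 2) ->
  ps_semigroup q0 t n \/ n <= F /\ ps_semigroup q0 t (F - n).
Proof.
move=> q0_gt0 t_gt1 EF.
pose l := n %% q0; pose k := (n %/ q0) %% t; pose z := (n %/ q0) %/ t.
(* Adding [q0] keeps [z - l] natural; this [c] is one more than the quotient of [z - l] by [q0]. *)
pose c := (z + q0 - l) %/ q0; pose j := (z + q0 - l) %% q0.
have lt_l : l < q0 by rewrite ltn_mod.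
have lt_k : k < t by rewrite ltn_mod ltnW.
have lt_j : j < q0 by rewrite ltn_mod.
have nE : n = q0 * (t * z + k) + l.
  by rewrite {1}(divn_eq n q0) {1}(divn_eq (n %/ q0) t) -/z -/k -/l; ring.
have zE : z + q0 = q0 * c + j + l.
  by have := divn_eq (z + q0 - l) q0; rewrite -/c -/j; lia.
move: lt_l lt_k lt_j nE zE.
move: l k z c j => l k z c j lt_l lt_k lt_j nE zE.
have zE' := congr1 (fun x => x * (q0 * t)) zE.
have tE : t = (t - 1) + 1 by lia.
have [le_c|lt_c] := leqP (1 + j + k + l * (t - 1)) c.
  left; apply/ps_semigroupP; exists (c - (1 + j + k + l * (t - 1))), j, k, l.
  move: le_c => /subnK; move: (c - _) => i cE; subst c.
  move: zE' nE; rewrite /= tE addnK -mulnn; move: (t - 1) => u; lia.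
right; suff FE : F = n + ((j + k + l * (t - 1) - c) * (t * q0 ^ 2)
    + (q0 - 1 - j) * (t * q0 ^ 2 + t * q0) + (t - 1 - k) * (t * q0 ^ 2 + q0)
    + (q0 - 1 - l) * ((t - 1) * (t * q0 ^ 2) + t * q0 + 1)).
  split; first by rewrite FE leq_addr.
  by rewrite FE addKn; apply/ps_semigroupP; do 4 eexists; reflexivity.
have /subnK : c <= j + k + l * (t - 1) by lia.
have /subnK : j <= q0 - 1 by lia.
have /subnK : k <= t - 1 by lia.
have /subnK : l <= q0 - 1 by lia.
move: (_ - c) (_ - j) (_ - k) (_ - l) => i j' k' l' lE kE jE iE.
have {}lE := congr1 (fun x => x * ((t - 1) * (t * q0 ^ 2) + t * q0 + 1)) lE.
have {}kE := congr1 (fun x => x * (t * q0 ^ 2 + q0)) kE.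
have {}jE := congr1 (fun x => x * (t * q0 ^ 2 + t * q0)) jE.
have {}iE := congr1 (fun x => x * (t * q0 ^ 2)) iE.
move: EF lE kE jE iE zE' nE; rewrite /= tE addnK -mulnn.
have -> : q0 = (q0 - 1) + 1 by lia.
rewrite addnK; move: (t - 1) (q0 - 1) => u p; lia.
Qed.

(* The translate is of [g - q / 2], with [t = 2 u]. If [x = q0 y + l] and
   [(q0 - 1) u + y = t c + k] with [l < q0], [k < t], then the normal form has
   [j = c - l] and [i = u q0 - 1 - c - k - l (t - 2)]. *)
Lemma ps_semigroup_half_blocks (q0 u x : nat) :
    0 < q0 -> 0 < u -> q0 = 1 \/ ~~ odd q0 ->
    x < u * q0 ^ 2 -> 2 * (x %% q0) < q0 ->
  ps_semigroup q0 (2 * u) (u * q0 * (2 * u * q0 ^ 2 - 1 - q0) + x).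
Proof.
move=> q0_gt0 u_gt0 q0_par; rewrite -mulnn mulnA {1}(divn_eq x q0) => lt_x lt_l.
have lt_y : x %/ q0 < u * q0.
  by rewrite -(ltn_pmul2r q0_gt0); apply: leq_ltn_trans lt_x; rewrite leq_addr.
rewrite {1}(divn_eq x q0); move: lt_y lt_l {lt_x}.
move: (x %/ q0) (x %% q0) => y l lt_y lt_l.
(* Modulo [2 * u], the factor [u (q - 1 - q0)] is [(q0 - 1) u]. *)
have := divn_eq ((q0 - 1) * u + y) (2 * u).
have : ((q0 - 1) * u + y) %% (2 * u) < 2 * u by rewrite ltn_mod muln_gt0.
move: (_ %/ _) (_ %% _) => c k lt_k zE.
have q0E : q0 = 1 /\ l = 0 \/ 2 * l + 2 <= q0 by lia.
have le_lc : l <= c.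
  case: q0E => [[_ ->] //|le_l]; rewrite leqNgt; apply/negP => lt_c.
  have : 2 * c.+1 * u + u <= (q0 - 1) * u by rewrite -mulSnr leq_mul2r; lia.
  by move: zE lt_k; lia.
have le_c : c < q0.
  rewrite -(ltn_pmul2r u_gt0) -(ltn_pmul2r (isT : 0 < 2)).
  by move: zE lt_y; rewrite mulnBl; lia.
have le_i : c + k + l * (2 * u - 2) <= u * q0 - 1.
  case: q0E => [[q1 ->]|le_l]; first by move: zE lt_y le_c; rewrite q1; lia.
  have le1 : (2 * l + 2) * (u - 1) <= q0 * (u - 1) by rewrite leq_mul2r le_l orbT.
  (* At the largest [c], the bound on [y] forces [k < u]; for smaller [c], [k < 2 * u] is enough. *)
  have [cE|lt_c] : c = q0 - 1 \/ c < q0 - 1 by lia.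
    have : k < u by move: zE lt_y; rewrite cE !mulnBl; lia.
    move: le1 cE; have -> : 2 * u - 2 = 2 * (u - 1) by lia.
    have -> : u = (u - 1) + 1 by lia.
    by rewrite addnK; move: (u - 1); lia.
  move: le1 lt_c lt_k; have -> : 2 * u - 2 = 2 * (u - 1) by lia.
  have -> : u = (u - 1) + 1 by lia.
  by rewrite addnK; move: (u - 1); lia.
apply/ps_semigroupP.
exists (u * q0 - 1 - (c + k + l * (2 * u - 2))), (c - l), k, l.
move: le_i => /subnK; move: (_ - (_ + _)) => i iE.
move: le_lc => /subnK; move: (_ - l) => j jE; subst c.
have {}iE := congr1 (fun a => a * (2 * u * (q0 * q0))) iE.
have {}zE := congr1 (fun a => a * q0) zE.
have le_q : u * q0 * (q0 + 1) <= u * q0 * (2 * u * (q0 * q0)).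
  rewrite leq_mul2l; apply/orP; right; apply: leq_trans (_ : 2 * q0 * q0 <= _).
    have : q0 * 1 <= q0 * q0 by rewrite leq_mul2l q0_gt0 orbT.
    by lia.
  have : 1 * (q0 * q0) <= u * (q0 * q0) by rewrite leq_mul2r u_gt0 orbT.
  by lia.
move: iE zE le_q.
have -> : 2 * u * q0 ^ 2 - 1 - q0 = 2 * u * q0 ^ 2 - (q0 + 1) by lia.
rewrite /= (mulnBr (u * q0)) -mulnn.
have -> : u = (u - 1) + 1 by lia.
have -> : q0 = (q0 - 1) + 1 by lia.
have -> : 2 * (u - 1 + 1) - 2 = 2 * (u - 1) by lia.
have -> : 2 * (u - 1 + 1) - 1 = 2 * (u - 1) + 1 by lia.
rewrite addnK; move: (u - 1) (q0 - 1) => v p.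
have -> : (v + 1) * (p + 1) - 1 = v * (p + 1) + p by lia.
lia.
Qed.

(** * The maximum of [sigma] *)

(** The element [s] itself accounts for the [+ 1], which cancels the one in [sigma]. *)
Lemma count_uptoE (S : set nat) (s : nat) :
  S s -> count_upto S s = count_below (fun n => n \in S) s + 1.
Proof.
move=> Ss; rewrite -[1]/(nat_of_bool true) -(mem_set Ss) -count_belowS.
by rewrite /count_upto -sum1_card big_mkcond.
Qed.

Theorem theorem4p10 (q0 t : nat) (hq0 : 0 < q0) (ht : 1 < t)
    (hq : exists k : nat, t * q0 ^ 2 = 2 ^ k) :
  let q := t * q0 ^ 2 in
  let S := ps_semigroup q0 t in
  let g : rat := (q%:R * (q%:R - 1) / (2 * q0%:R))%R in
  exists2 m : nat, (m%:R = g - q%:R / 2)%R &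
    up_to_conductor S m /\
    forall s : nat, up_to_conductor S s -> (sigma S s <= sigma S m)%R.
Proof.
move=> q S g.
have [/frobeniusP frobS /frobS[_ le_frob]] := ps_semigroup_numerical hq0 ht hq.
have [_ SND] : additive_submonoid S by apply: generated_by_submonoid.
have q0_par : q0 = 1 \/ ~~ odd q0.
  have [k qE] := hq.
  have /(dvdn_pfactor _ _ (isT : prime 2))[[|j] _ ->] : q0 %| 2 ^ k.
  - by rewrite -qE -mulnn mulnA dvdn_mull.
  - by left.
  - by right; rewrite oddX.
have [u tE] : exists u, t = 2 * u.
  have [k qE] := hq.
  have /(dvdn_pfactor _ _ (isT : prime 2))[[|j] _ tE] : t %| 2 ^ k.
  - by rewrite -qE dvdn_mulr.
  - by rewrite tE in ht.
  - by exists (2 ^ j); rewrite tE expnS.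
have u_gt0 : 0 < u by lia.
have qE : q = 2 * (u * q0 ^ 2) by rewrite /q tE mulnA.
have lt_q0q : q0 < q.
  rewrite qE -mulnn.
  have : 1 * (q0 * q0) <= u * (q0 * q0) by rewrite leq_mul2r u_gt0 orbT.
  have : q0 * 1 <= q0 * q0 by rewrite leq_mul2l hq0 orbT.
  by lia.
pose G := u * q0 * (q - 1); pose p := u * q0 ^ 2; pose m := G - p.
have mE : m = u * q0 * (q - 1 - q0).
  by rewrite /m /G /p -mulnn mulnA -mulnBr.
have le_pG : p <= G.
  by rewrite /p /G -mulnn mulnA leq_mul2l; apply/orP; right; lia.
have mG : m + p = G by rewrite /m subnK.
(* [G] is the natural number equal to [g], and [2 * G - 1] is the gap [F] of the reflection
   [n -> F - n]. *)
have FE : 2 * G - 1 + 1 + t * q0 = t * q0 * (t * q0 ^ 2).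
  have : 0 < u * q0 * (q - 1) by rewrite !muln_gt0 u_gt0 hq0; lia.
  rewrite -/q /G tE; have -> : q = (q - 1) + 1 by lia.
  by rewrite addnK; move: (q - 1); lia.
have nSF := ps_frobenius_gap _ _ _ hq0 ht FE.
have symS n : n < 2 * G -> (2 * G - 1 - n \in S) = ~~ (n \in S).
  move=> lt_n; apply/idP/idP => [/set_mem SFn|/negP nSn].
    apply/negP => /set_mem Sn; apply: nSF.
    by have := SND _ _ SFn Sn; rewrite subnK //; lia.
  have [Sn|[_ SFn]] := ps_semigroup_cover _ _ _ n hq0 ht FE; last exact: mem_set.
  by case: nSn; apply: mem_set.
have perS n : n \in S -> n + 2 * p \in S.
  move=> /set_mem Sn; apply/mem_set; refine (SND _ _ Sn _).
  have -> : 2 * p = 1 * q by rewrite mul1n qE.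
  by apply: generated_by_mulr; left; left; left.
have p_gt0 : 0 < p by rewrite muln_gt0 u_gt0 expn_gt0 hq0.
have blockS x : x < p -> 2 * (x %% q0) < q0 -> S (m + x).
  by rewrite mE /S /q tE; apply: ps_semigroup_half_blocks.
have half s : G - p <= s <= G ->
    s + 2 * count_below (fun n => n \in S) (G - p)
      <= G - p + 2 * count_below (fun n => n \in S) s.
  move=> /andP[/subnK sE le_sG].
  have := @count_below_half_blocks (fun n => n \in S) m q0 (s - m) q0_par hq0.
  have -> : m + (s - m) = s by rewrite /m; lia.
  rewrite -/m in sE * => H.
  have /H : forall x, x < s - m -> 2 * (x %% q0) < q0 -> m + x \in S.
    move=> x lt_x lt_xq; apply/mem_set; refine (blockS _ _ lt_xq).
    by apply: leq_trans lt_x _; rewrite leq_subLR mG.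
  by move: sE; move: (s - m) => d; lia.
have Sm : S m.
  by have := blockS 0 p_gt0; rewrite mod0n addn0; apply.
have max_m := gap_excess_max _ _ _ p_gt0 le_pG perS symS half.
exists m.
  rewrite /m natrB // /g /G /p natrM natrM natrB 1?natrM; last by lia.
  have : (q0%:R != 0 :> rat)%R by rewrite pnatr_eq0 -lt0n.
  by rewrite qE !natrM => q0_neq0; field.
split; first split=> //=.
  have : 2 * G - 1 <= frobenius S by apply: le_frob.
  by rewrite /conductor /m; lia.
move=> s [Ss _]; have := max_m s; rewrite -/m /sigma !count_uptoE //.
by rewrite -(ler_nat rat) natrD natrM natrD natrM
  !(natrD _ (count_below _ _)); lra.
Qed.
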